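(* Let $T>0$, $\varepsilon>0$, let $u,v$ be two real-valued measurable functions on $I=[0,T]$, and let $H$ be the Heaviside step function. Then $$(u+\varepsilon v)_+=(u)_++\varepsilon H(u)v+\varepsilon\chi_\varepsilon(u,v),$$ where $\chi_\varepsilon(u,v)$ is a non-negative piecewise linear function of $(u,v)$ which is $1$-Lipschitz with respect to $v$. Moreover, let $M>0$, $J_\varepsilon=\{t\in I:\ |u(t)|\le\varepsilon M\}$, and let $\mu_\varepsilon(T)$ be the measure of $J_\varepsilon$. If $|v(t)|\le M$ for every $t\in I$, then $$|\chi_\varepsilon(u,v)|\le|v|\le M,\qquad\int_0^T|\chi_\varepsilon(u(t),v(t))|\,dt\le M\mu_\varepsilon(T).$$
   Context: For real $x$, $x_+=\max(0,x)$; $H(x)=1$ if $x>0$ and $H(x)=0$ otherwise. The function $\chi_\varepsilon:\mathbb{R}^2\to\mathbb{R}$ is defined by the displayed identity, i.e. $\chi_\varepsilon(u,v)=\varepsilon^{-1}\big((u+\varepsilon v)_+-u_+-\varepsilon H(u)v\big)$. Piecewise linear (not necessarily continuous) means that $\mathbb{R}^2$ is a finite union of convex cones on each of which $\chi_\varepsilon$ is linear. ''$1$-Lipschitz with respect to $v$'' means that for each fixed $u\in\mathbb{R}$ the map $v\mapsto\chi_\varepsilon(u,v)$ is $1$-Lipschitz. *)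

(* Defs.v *)
From HB Require Import structures.
From mathcomp Require Import all_boot all_order all_algebra.
From mathcomp Require Import all_classical all_reals all_analysis.

Set Implicit Arguments.
Unset Strict Implicit.
Unset Printing Implicit Defensive.

Import Order.TTheory GRing.Theory Num.Theory.
Import numFieldNormedType.Exports.

Local Open Scope classical_set_scope.
Local Open Scope ring_scope.

Definition pos_part {R : realType} (x : R) : R := Num.max 0 x.

(* The value at the jump matters: heaviside 0 = 0. *)
Definition heaviside {R : realType} (x : R) : R := if 0 < x then 1 else 0.

(* The remainder of the first-order expansion of the positive part at u in the
   direction v, rescaled by 1 / eps. *)
Definition chi {R : realType} (eps u v : R) : R :=
  eps^-1 * (pos_part (u + eps * v) - pos_part u - eps * heaviside u * v).

(* Only strictly positive dilations are required, so a convex cone need not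
   contain the origin (e.g. an open half-plane through 0 is a convex cone). *)
Definition convex_cone {R : realType} {E : lmodType R} (C : set E) : Prop :=
  convex_set C /\ forall (a : R) (x : E), 0 < a -> C x -> C (a *: x).

(* No continuity is imposed, and the cones may overlap. *)
Definition piecewise_linear {R : realType} {E : lmodType R} (f : E -> R) :
    Prop :=
  exists (n : nat) (C : 'I_n -> set E),
    \bigcup_i C i = [set: E] /\
    forall i, convex_cone (C i) /\
      exists L : {linear E -> R^o}, forall x, C i x -> f x = L x.

(* R with its Lebesgue sigma-algebra, i.e. the Caratheodory-measurable sets of
   the outer measure induced by interval length (the completion of the Borel
   sets).  It is the domain of completed_lebesgue_measure; the default
   measurable structure on R is the Borel one. *)
Definition lebesgueType (R : realType) :=
  caratheodory_type ((wlength (@idfun R))^*)%mu.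

(* The domain carries the Lebesgue sigma-algebra, the codomain the Borel one. *)
Definition lebesgue_measurable_fun {R : realType} (D : set R) (f : R -> R) :
    Prop :=
  @measurable_fun _ _ (lebesgueType R) R D f.

Definition lebesgue_measurable {R : realType} (A : set R) : Prop :=
  @measurable _ (lebesgueType R) A.

(* Main.v *)
Require Import Defs.
From HB Require Import structures.
From mathcomp Require Import all_boot all_order all_algebra.
From mathcomp Require Import all_classical all_reals all_analysis.
From mathcomp Require Import measurable_realfun lra ring.

(** Put w := y + x / eps, so that x + eps y = eps w.  If x <= 0, then x and the
    Heaviside factor contribute nothing and chi is the positive part of w.  If
    x > 0, subtracting the linear expansion x + eps y = eps w from the positive
    part of eps w leaves the negative part, so chi is the positive part of - w.
    Hence, in all cases,

        chi eps x y = (s (y + x / eps))_+,   s = -1 if x > 0, s = 1 otherwise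

    (lemma [chiE]), and the pointwise claims are read off this formula.
    - Positive parts are non-negative and 1-Lipschitz and |s| = 1, which gives
      the sign and the Lipschitz property in y.  Since chi vanishes at y = 0,
      the Lipschitz property gives |chi| <= |y|.
    - The lines x = 0 and w = 0 cut the plane into four convex cones, on each of
      which s is constant and w does not change sign, so chi is linear there.
    - If x and x + eps y are on the same side of the jump there is no remainder;
      this happens as soon as eps |y| < |x| ([chi_eq0]).

    When |v| <= M, the last point says that chi vanishes outside the set J where
    |u| <= eps M, so |chi| <= M 1_J; integrating this bound gives the estimate by
    M times the measure of J.  The measure theory holds for an arbitrary measure;
    Lebesgue measure enters only through the measurability and the finite
    measure of [0, T]. *)

Set Implicit Arguments.
Unset Strict Implicit.
Unset Printing Implicit Defensive.

Import Order.TTheory GRing.Theory Num.Theory.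
Import numFieldNormedType.Exports.

Local Open Scope classical_set_scope.
Local Open Scope ring_scope.

Lemma normr_pos_part_sub (R : realType) (x y : R) :
  `|pos_part x - pos_part y| <= `|x - y|.
Proof.
rewrite /pos_part /Num.max.
case: ifPn; rewrite -?leNgt => hx; case: ifPn; rewrite -?leNgt => hy;
  rewrite ler_norml; apply/andP; split;
  have := ler_norm (x - y); have := ler_norm (- (x - y)); rewrite normrN; lra.
Qed.

(** The jump of the Heaviside function and the kink of the positive part are
    both absorbed in the sign factor: the linear expansion is exact on one side
    of the line x + eps y = 0, and which side that is depends only on the sign
    of x. *)
Lemma chiE (R : realType) (eps x y : R) : 0 < eps ->
  chi eps x y = pos_part ((if 0 < x then -1 else 1) * (y + eps^-1 * x)).
Proof.
move=> eps_gt0.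
have factor : x + eps * y = eps * (y + eps^-1 * x).
  by field; rewrite gt_eqF.
have pos_partM z : pos_part (eps * z) = eps * pos_part z.
  by rewrite /pos_part maxr_pMr ?ltW// mulr0.
have xE : x = eps * (eps^-1 * x) by rewrite mulVKf// gt_eqF.
rewrite /chi factor pos_partM {2}xE pos_partM -mulrA -!mulrBr mulKf ?gt_eqF//.
rewrite /heaviside; case: ifPn => x0.
  have : 0 < eps^-1 * x by rewrite mulr_gt0 ?invr_gt0.
  rewrite /pos_part /Num.max; set w := eps^-1 * x => w0.
  by do 3 (case: ifPn; rewrite -?leNgt => ?); lra.
have : eps^-1 * x <= 0 by rewrite pmulr_rle0 ?invr_gt0// leNgt.
rewrite /pos_part /Num.max; set w := eps^-1 * x => w0.
by do 3 (case: ifPn; rewrite -?leNgt => ?); lra.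
Qed.

Lemma chi_ge0 (R : realType) (eps x y : R) : 0 < eps -> 0 <= chi eps x y.
Proof. by move=> eps_gt0; rewrite chiE// /pos_part le_max lexx. Qed.

Lemma pos_part_expansion (R : realType) (eps x y : R) : 0 < eps ->
  pos_part (x + eps * y) =
    pos_part x + eps * heaviside x * y + eps * chi eps x y.
Proof.
by move=> eps_gt0; rewrite /chi mulVKf ?gt_eqF//; ring.
Qed.

(** The shift by x / eps cancels in the difference and the sign factor is the
    same at y and z, so only the Lipschitz bound of the positive part is left. *)
Lemma normr_chi_sub (R : realType) (eps x y z : R) : 0 < eps ->
  `|chi eps x y - chi eps x z| <= `|y - z|.
Proof.
move=> eps_gt0; rewrite !chiE//; apply: le_trans (normr_pos_part_sub _ _) _.
rewrite -mulrBr opprD addrACA subrr addr0 normrM.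
by case: ifP; rewrite ?normrN normr1 mul1r.
Qed.

(** A perturbation smaller than the base point cannot change its sign, and the
    positive part is linear on each side of 0. *)
Lemma chi_eq0 (R : realType) (eps x y : R) : 0 < eps ->
  eps * `|y| < `|x| -> chi eps x y = 0.
Proof.
move=> eps_gt0 yx; rewrite chiE// /pos_part; apply/max_l.
have : `|y| < `|eps^-1 * x|.
  by rewrite normrM gtr0_norm ?invr_gt0// ltr_pdivlMl.
case: ifPn => x0.
  have w0 : 0 < eps^-1 * x by rewrite mulr_gt0 ?invr_gt0.
  by rewrite (gtr0_norm w0) ltr_norml; lra.
have w0 : eps^-1 * x <= 0 by rewrite pmulr_rle0 ?invr_gt0// leNgt.
by rewrite (ler0_norm w0) ltr_norml; lra.
Qed.

Lemma chi0r (R : realType) (eps x : R) : chi eps x 0 = 0.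
Proof. by rewrite /chi !mulr0 addr0 subrr subr0 mulr0. Qed.

(** The Lipschitz bound compared with the value at y = 0. *)
Lemma normr_chi_le (R : realType) (eps x y : R) : 0 < eps ->
  `|chi eps x y| <= `|y|.
Proof.
by move=> eps_gt0; have := normr_chi_sub x y 0 eps_gt0; rewrite chi0r !subr0.
Qed.

Lemma convex_cone_ge0 (R : realType) (E : lmodType R) (L : {linear E -> R^o}) :
  convex_cone [set p | 0 <= L p].
Proof.
split; last first.
  by move=> a x a0 /= Lx; rewrite linearZ; exact: mulr_ge0 (ltW a0) Lx.
move=> x y l; rewrite !inE/= => Lx Ly; rewrite linearD !linearZ.
by apply: addr_ge0; (apply: mulr_ge0; last by []); rewrite ?subr_ge0.
Qed.

(** The open half-planes are needed because chi jumps across x = 0: the line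
    itself belongs to the side x <= 0 only. *)
Lemma convex_cone_gt0 (R : realType) (E : lmodType R) (L : {linear E -> R^o}) :
  convex_cone [set p | 0 < L p].
Proof.
split; last by move=> a x a0 /= Lx; rewrite linearZ; exact: mulr_gt0 a0 Lx.
(* Only for weights other than 0 and 1 are both summands strictly positive. *)
apply/(@convex_setW _ E) => x y; rewrite !inE/= => Lx Ly l l0 l1; rewrite inE/=.
rewrite linearD !linearZ; apply: addr_gt0; apply: mulr_gt0 => //.
by rewrite /= subr_gt0.
Qed.

Lemma convex_coneI (R : realType) (E : lmodType R) (A B : set E) :
  convex_cone A -> convex_cone B -> convex_cone (A `&` B).
Proof.
move=> [cA sA] [cB sB]; split=> [x y l|a x a0 [Ax Bx]]; last first.
  by split; [exact: sA|exact: sB].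
rewrite !in_setI => /andP[Ax Bx] /andP[Ay By].
by apply/andP; split; [exact: cA|exact: cB].
Qed.

Definition linear_form2 {R : realType} (a b : R) (p : R * R) : R^o :=
  a * p.1 + b * p.2.

Fact linear_form2_linear (R : realType) (a b : R) : linear (linear_form2 a b).
Proof.
move=> k p q; rewrite /linear_form2 /=.
rewrite -![_ *: _]/(_ * _); ring.
Qed.

HB.instance Definition _ (R : realType) (a b : R) :=
  GRing.isLinear.Build R _ R^o _ (linear_form2 a b) (linear_form2_linear a b).

(** The four cones are indexed by two bits: the high bit of i tells whether
    x > 0 or x <= 0, the low bit whether w >= 0 or w <= 0, for w = y + x / eps
    (the line w = 0 may be shared, since chi is continuous across it).  On the
    two cones where the bits agree chi vanishes; on the others it is the linear
    form c w with c = 1 or c = -1. *)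
Lemma piecewise_linear_chi (R : realType) (eps : R) : 0 < eps ->
  piecewise_linear (fun p : R * R => chi eps p.1 p.2).
Proof.
move=> eps_gt0.
pose sgn (b : bool) : R := if b then 1 else -1.
pose H (b : bool) : set (R * R) := if b then [set p | 0 < linear_form2 1 0 p]
  else [set p | 0 <= linear_form2 (-1) 0 p].
pose W (b : bool) : set (R * R) :=
  [set p | 0 <= linear_form2 (sgn b * eps^-1) (sgn b) p].
have bit (b c : bool) : (b.*2 + c < 4)%N by case: b; case: c.
exists 4, (fun i => H (1 < i)%N `&` W (odd i)); split.
  rewrite -subTset => -[x y] _; rewrite /bigcup/=.
  exists (Ordinal (bit (0 < x) (0 <= y + eps^-1 * x))) => //=.
  rewrite oddD odd_double oddb /=.
  have hi (b c : bool) : (1 < b.*2 + c)%N = b by case: b; case: c.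
  rewrite hi /H /W /sgn /linear_form2; split.
    by case: ifPn => /=; rewrite -?leNgt => x_sign; lra.
  by rewrite /= -mulrA; case: ifPn; rewrite -?ltNge => w_sign; lra.
move=> i; split.
  apply: convex_coneI; last exact: convex_cone_ge0.
  by rewrite /H; case: ifP => _; [exact: convex_cone_gt0|exact: convex_cone_ge0].
pose c := if (1 < i)%N then if odd i then 0 else -1 : R
          else if odd i then 1 else 0.
exists (linear_form2 (c * eps^-1) c) => -[x y] [].
rewrite /H /W /= chiE//.
set w := eps^-1 * x.
have slopeE k : linear_form2 (k * eps^-1) k (x, y) = k * (y + w).
  by rewrite /linear_form2/= -mulrA -/w; ring.
rewrite !slopeE /c /sgn => hx hw.
have -> : (0 < x) = (1 < i)%N.
  by move: hx; case: ifP => _; rewrite /linear_form2/= => ?; apply/idP; lra.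
move: hw; rewrite /pos_part /Num.max.
by case: (1 < i)%N; case: (odd i); case: ifPn; rewrite -?leNgt; lra.
Qed.

Lemma measurable_pos_part d (T : measurableType d) (R : realType)
    (D : set T) (f : T -> R) :
  measurable_fun D f -> measurable_fun D (fun t => pos_part (f t)).
Proof. by move=> mf; exact: measurable_maxr. Qed.

Lemma measurable_chi d (T : measurableType d) (R : realType) (eps : R)
    (D : set T) (u v : T -> R) :
  measurable_fun D u -> measurable_fun D v ->
  measurable_fun D (fun t => chi eps (u t) (v t)).
Proof.
move=> mu mv; rewrite /chi.
have mH : measurable_fun D (fun t => heaviside (u t)).
  move=> mD; move: (mD); apply: measurable_fun_if => //.
  exact: measurable_fun_ltr.
apply: measurable_funM => //; apply: measurable_funB.
  apply: measurable_funB; apply: measurable_pos_part => //.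
  by apply: measurable_funD => //; exact: measurable_funM.
by apply: measurable_funM => //; exact: measurable_funM.
Qed.

Lemma measurable_normr_le d (T : measurableType d) (R : realType)
    (D : set T) (f : T -> R) (c : R) : measurable D -> measurable_fun D f ->
  measurable [set t | D t /\ `|f t| <= c].
Proof.
move=> mD mf; rewrite (_ : mkset _ = D `&` f @^-1` `[- c, c]); last first.
  by apply/seteqP; split=> t [Dt]/=; rewrite in_itv/= -ler_norml.
by apply: mf => //; exact: measurable_itv.
Qed.

(** The integrand is dominated by M times the indicator of the set J below: on J
    by the bound |chi| <= |v|, and off J because chi vanishes there. *)
Lemma integral_normr_chi_le d (T : measurableType d) (R : realType)
    (mu : {measure set T -> \bar R}) (eps M : R) (D : set T) (u v : T -> R) :
  0 < eps -> 0 <= M -> measurable D ->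
  measurable_fun D u -> measurable_fun D v ->
  (forall t, D t -> `|v t| <= M) ->
  (\int[mu]_(t in D) `|chi eps (u t) (v t)|%:E <=
    M%:E * mu [set t | D t /\ (`|u t| <= eps * M)%R])%E.
Proof.
move=> eps_gt0 M_ge0 mD m_u m_v v_le.
set J := [set t | _].
have mJ : measurable J by exact: measurable_normr_le.
have -> : mu J = (\int[mu]_(t in D) (\1_J t)%:E)%E.
  by rewrite integral_indic// setIidl// => t [].
rewrite -ge0_integralZl//; last exact/measurable_EFinP.
apply: ge0_le_integral => //.
- apply/measurable_EFinP; apply: measurableT_comp => //.
  exact: measurable_chi.
- by apply/measurable_EFinP; apply: measurable_funM.
move=> t Dt; rewrite -EFinM lee_fin.
have [Jt|nJt] := boolP (t \in J).
  by rewrite indicE Jt mulr1 (le_trans (normr_chi_le _ _ _))// v_le.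
rewrite chi_eq0 ?normr0 ?mulr_ge0//.
have u_gt : eps * M < `|u t|.
  by rewrite ltNge; apply: contra nJt => u_le; rewrite inE.
by apply: le_lt_trans u_gt; rewrite ler_pM2l// v_le.
Qed.

Lemma lebesgue_measurable_itv (R : realType) (i : interval R) :
  lebesgue_measurable [set` i].
Proof. by apply: sub_caratheodory; exact: measurable_itv. Qed.

(** Both measures are restrictions of the same outer measure, so they agree by
    conversion; this makes the known lengths of intervals available for the
    completed measure. *)
Lemma completed_lebesgue_measure_itv (R : realType) (i : interval R) :
  completed_lebesgue_measure [set` i] = lebesgue_measure [set` i].
Proof. by []. Qed.

Theorem lemma1 (R : realType) (T eps : R) (u v : R -> R)
    (T_gt0 : 0 < T) (eps_gt0 : 0 < eps)
    (meas_u : lebesgue_measurable_fun `[0, T] u)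
    (meas_v : lebesgue_measurable_fun `[0, T] v) :
  (forall t : R, t \in `[0, T] ->
     pos_part (u t + eps * v t) =
       pos_part (u t) + eps * heaviside (u t) * v t
         + eps * chi eps (u t) (v t)) /\
  (forall x y : R, 0 <= chi eps x y) /\
  piecewise_linear (fun p : R * R => chi eps p.1 p.2) /\
  (forall x : R, 1.-lipschitz (fun y : R => chi eps x y)) /\
  (forall M : R, 0 < M ->
     (forall t : R, t \in `[0, T] -> `|v t| <= M) ->
     let J : set R :=
       [set t | t \in `[0, T] /\ `|u t| <= eps * M] in
     (forall t : R, t \in `[0, T] ->
        `|chi eps (u t) (v t)| <= `|v t| /\ `|v t| <= M) /\
     lebesgue_measurable J /\
     completed_lebesgue_measure.-integrable `[0, T]
       (fun t => (chi eps (u t) (v t))%:E) /\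
     (\int[completed_lebesgue_measure]_(t in `[0%R, T])
          `|chi eps (u t) (v t)|%:E
        <= M%:E * completed_lebesgue_measure J)%E).
Proof.
split; first by move=> t _; exact: pos_part_expansion.
split; first by move=> x y; exact: chi_ge0.
split; first exact: piecewise_linear_chi.
split; first by move=> x [y z] _ /=; rewrite mul1r; exact: normr_chi_sub.
move=> M M_gt0 v_le J.
have mI : lebesgue_measurable `[0, T] := lebesgue_measurable_itv _.
split.
  by move=> t tI; split; [exact: normr_chi_le|exact: v_le].
split; first exact: measurable_normr_le mI meas_u.
split; last exact: integral_normr_chi_le (ltW M_gt0) mI meas_u meas_v v_le.
apply: (measurable_bounded_integrable mI).
- rewrite /= completed_lebesgue_measure_itv lebesgue_measure_itv/= lte_fin.
  by rewrite T_gt0 ltry.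
- exact: measurable_chi.
- exists M; split; first exact: num_real.
  move=> K MK t tI; apply: le_trans (ltW MK).
  by apply: le_trans (v_le t tI); exact: normr_chi_le.
Qed.
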